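(* Let $\alpha: I\to\mathbb{E}^3$ be a unit-speed curve with $\kappa\neq 0$, and let $K(s,v)=B(s)+vT(s)$ be the Darboux developable surface of $\alpha$. Then the parameter curves of $K$ satisfy the following. (i) For fixed $v$, the $s$-parameter curve $s\mapsto K(s,v)$ is an asymptotic curve if and only if the curve $\alpha$ is a plane curve or a general helix. (ii) For fixed $v$, the $s$-parameter curve $s\mapsto K(s,v)$ is a geodesic curve if and only if the curve $\alpha$ is a general helix. (iii) The $v$-parameter curves are straight lines. (iv) The parameter curves (both families) are lines of curvature.
   Context: All maps are smooth and $I\subset\mathbb{R}$ is an open interval. For a unit-speed curve $\alpha$ with $\kappa=\|\alpha''\|>0$, the Frenet frame is $T=\alpha'$, $N=\alpha''/\|\alpha''\|$, $B=T\times N$, with $T'=\kappa N$, $N'=-\kappa T+\tau B$, $B'=-\tau N$. A plane curve is one with $\tau=0$; a general helix is a curve for which $\tau/\kappa$ is constant. The unit normal of $K$ is $U=\frac{K_s\times K_v}{\|K_s\times K_v\|}$; for this surface $U=\pm B$. The $s$-parameter curves are $s\mapsto K(s,v)$ with $v$ fixed, and the $v$-parameter curves are $v\mapsto K(s,v)$ with $s$ fixed. An $s$-parameter curve is a geodesic curve if its acceleration vector is normal to the surface, i.e. $U\times K_{ss}=0$ along it, and an asymptotic curve if its acceleration vector is tangent to the surface, i.e. $\langle U,K_{ss}\rangle=0$ along it (similarly for $v$-parameter curves with $K_{vv}$). A curve on the surface is a line of curvature if $S(t)$ and $t$ are linearly dependent along it, where $t$ is its tangent and $S$ is the shape operator of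 the surface.
   Formalization: In (i) and (ii), false for a fixed v when a helix has τ/κ ≠ 0 and τ/κ ≠ v, ''general helix'' is read as ''helix with τ/κ = v'' for each fixed v, and the equivalence with ''general helix'' as stated is given for ''some v'' in place of ''fixed v''. *)

(* Defs.v *)
From HB Require Import structures.
From mathcomp Require Import all_boot all_order all_algebra.
From mathcomp Require Import all_classical all_reals all_analysis.

Set Implicit Arguments.
Unset Strict Implicit.
Unset Printing Implicit Defensive.

Import Order.TTheory GRing.Theory Num.Theory.
Import numFieldNormedType.Exports.

Local Open Scope classical_set_scope.
Local Open Scope ring_scope.

Section EuclideanSpace.
Context {R : realType}.
Implicit Types u v : 'rV[R]_3.

Definition dot u v : R := (u *m v^T) 0 0.

(* The library norm `|u| on matrices is the sup norm, so the Euclidean norm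
   is introduced separately; both induce the same derivatives. *)
Definition enorm u : R := Num.sqrt (dot u u).

Definition normalize u : 'rV[R]_3 := (enorm u)^-1 *: u.

(* The index arithmetic is that of Z/3Z, which gives the usual cyclic formula
   (u_1 v_2 - u_2 v_1, u_2 v_0 - u_0 v_2, u_0 v_1 - u_1 v_0). *)
Definition cross u v : 'rV[R]_3 :=
  \row_(k < 3) (u 0 (k + 1) * v 0 (k + 2) - u 0 (k + 2) * v 0 (k + 1)).

End EuclideanSpace.

Section FrenetApparatus.
Context {R : realType}.
Variables (I : set R) (alpha : R -> 'rV[R]_3).

(* On an open set, being differentiable to every order is being C^oo. *)
Definition smooth_on : Prop :=
  forall (n : nat) (s : R), I s -> derivable (derive1n n alpha) s 1.

Definition unit_speed : Prop := forall s, I s -> enorm (derive1 alpha s) = 1.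

Definition curvature (s : R) : R := enorm (derive1n 2 alpha s).

Definition frenetT (s : R) : 'rV[R]_3 := derive1 alpha s.
Definition frenetN (s : R) : 'rV[R]_3 := normalize (derive1n 2 alpha s).
Definition frenetB (s : R) : 'rV[R]_3 := cross (frenetT s) (frenetN s).

(* The coefficient in the Frenet formula B' = - tau N. *)
Definition torsion (s : R) : R := - dot (derive1 frenetB s) (frenetN s).

Definition plane_curve : Prop := forall s, I s -> torsion s = 0.

Definition helix_of_ratio (c : R) : Prop :=
  forall s, I s -> torsion s / curvature s = c.

Definition general_helix : Prop := exists c, helix_of_ratio c.

End FrenetApparatus.

Section Surfaces.
Context {R : realType}.
(* A parametrized surface [K], with points of the parameter plane written
   [p = (s, v)], and a field [U] of unit normals along it. *)
Variables (K U : R * R -> 'rV[R]_3).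

Definition partial1 (F : R * R -> 'rV[R]_3) (p : R * R) : 'rV[R]_3 :=
  derive1 (fun s => F (s, p.2)) p.1.
Definition partial2 (F : R * R -> 'rV[R]_3) (p : R * R) : 'rV[R]_3 :=
  derive1 (fun v => F (p.1, v)) p.2.

Definition jacobian (F : R * R -> 'rV[R]_3) (p : R * R) : 'M[R]_(1 + 1, 3) :=
  col_mx (partial1 F p) (partial2 F p).

Definition normal_vector (p : R * R) : 'rV[R]_3 :=
  cross (partial1 K p) (partial2 K p).

Definition regular_point (p : R * R) : Prop := normal_vector p != 0.

(* S(w) = - D_w U.  At a regular point, a tangent vector is uniquely
   w = a K_s + b K_v; the row (a, b) is [w *m pinvmx (jacobian K p)], and
   then S(w) = - (a U_s + b U_v). *)
Definition shape_operator (p : R * R) (w : 'rV[R]_3) : 'rV[R]_3 :=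
  - (w *m pinvmx (jacobian K p) *m jacobian U p).

(* [c] is a curve in the parameter plane, defined on [J]; the curve on the
   surface is [K \o c]. *)
Variables (J : set R) (c : R -> R * R).

Definition asymptotic_curve : Prop :=
  forall t, J t -> dot (U (c t)) (derive1n 2 (K \o c) t) = 0.

Definition geodesic_curve : Prop :=
  forall t, J t -> cross (U (c t)) (derive1n 2 (K \o c) t) = 0.

(* The shape operator exists only where the surface is regular. *)
Definition line_of_curvature : Prop :=
  forall t, J t -> regular_point (c t) ->
    ~~ free [:: shape_operator (c t) (derive1 (K \o c) t); derive1 (K \o c) t].

End Surfaces.

Definition s_curve {R : realType} (v : R) : R -> R * R := fun s => (s, v).
Definition v_curve {R : realType} (s : R) : R -> R * R := fun v => (s, v).

Definition is_straight_line {R : realType} (L : set 'rV[R]_3) : Prop :=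
  exists q d : 'rV[R]_3, d != 0 /\ L = [set q + t *: d | t in [set: R]].

Section DarbouxDevelopable.
Context {R : realType}.
Variable alpha : R -> 'rV[R]_3.

Definition darboux (p : R * R) : 'rV[R]_3 :=
  frenetB alpha p.1 + p.2 *: frenetT alpha p.1.

(* K_s x K_v = - (v kappa - tau) B, so the normalized cross product is B or
   - B wherever it is defined.  Where v kappa = tau the surface is singular
   and the unit normal is taken to be B: the conditions U x K_ss = 0 and
   <U, K_ss> = 0 do not depend on the sign, and dividing by zero would make
   them hold by convention at such points. *)
Definition darboux_normal (p : R * R) : 'rV[R]_3 :=
  if normal_vector darboux p == 0 then frenetB alpha p.1
  else normalize (normal_vector darboux p).

End DarbouxDevelopable.

(* Main.v *)
(* The Frenet formulas give K_s = f N and K_v = T with f = v kappa - tau, hence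
   U = -sg(f) B wherever f <> 0 and K_ss = f' N + f (- kappa T + tau B).
   So <U, K_ss> = 0 iff f tau = 0, and the T-component of K_ss shows that
   U x K_ss = 0 iff f = 0.  The pointwise alternative f tau = 0 says that
   tau / kappa takes only the values 0 and v; being continuous on an interval
   it is constant, i.e. the whole curve is plane or a helix of ratio v.
   Finally U_s is a multiple of B' = - tau N, and U_v = 0. *)
Require Import Defs.
From mathcomp Require Import all_boot all_order all_algebra.
From mathcomp Require Import all_classical all_reals all_analysis.
From mathcomp Require Import ring lra.
Import Order.TTheory GRing.Theory Num.Theory.
Import numFieldNormedType.Exports.
Local Open Scope classical_set_scope.
Local Open Scope ring_scope.

Set Implicit Arguments.
Unset Strict Implicit.

(** * Inner and cross products in coordinates *)

Section VectorAlgebra.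
Context {R : realType}.
Implicit Types (u v w x : 'rV[R]_3) (a : R).

Lemma dotE u v : dot u v = u 0 0 * v 0 0 + u 0 1 * v 0 1 + u 0 2 * v 0 2.
Proof.
rewrite /dot mxE !big_ord_recl big_ord0 !mxE addr0 addrA.
by congr (_ * v _ _ + u _ _ * v _ _ + u _ _ * v _ _); apply: val_inj.
Qed.

Lemma row3P u v :
  u 0 0 = v 0 0 -> u 0 1 = v 0 1 -> u 0 2 = v 0 2 -> u = v.
Proof.
move=> e0 e1 e2; apply/rowP => -[[|[|[|//]]] lt_i].
- by rewrite (_ : Ordinal lt_i = 0) //; apply: val_inj.
- by rewrite (_ : Ordinal lt_i = 1) //; apply: val_inj.
- by rewrite (_ : Ordinal lt_i = 2) //; apply: val_inj.
Qed.

Lemma crossE u v :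
  [/\ cross u v 0 0 = u 0 1 * v 0 2 - u 0 2 * v 0 1,
      cross u v 0 1 = u 0 2 * v 0 0 - u 0 0 * v 0 2 &
      cross u v 0 2 = u 0 0 * v 0 1 - u 0 1 * v 0 0].
Proof.
by split; rewrite mxE; congr (u _ _ * v _ _ - u _ _ * v _ _); apply: val_inj.
Qed.

Lemma dotC u v : dot u v = dot v u.
Proof. by rewrite !dotE; ring. Qed.

Lemma dotDl u v w : dot (u + v) w = dot u w + dot v w.
Proof. by rewrite !dotE !mxE; ring. Qed.

Lemma dotZl a u v : dot (a *: u) v = a * dot u v.
Proof. by rewrite !dotE !mxE; ring. Qed.

Lemma dotZr a u v : dot u (a *: v) = a * dot u v.
Proof. by rewrite dotC dotZl dotC. Qed.

Lemma dot0l u : dot 0 u = 0.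
Proof. by rewrite -(scale0r u) dotZl mul0r. Qed.

Lemma dot_ge0 u : 0 <= dot u u.
Proof. by rewrite dotE; nra. Qed.

Lemma dot_eq0 u : (dot u u == 0) = (u == 0).
Proof.
apply/eqP/eqP => [|->]; last exact: dot0l.
by rewrite dotE => u0; apply: row3P; rewrite mxE; nra.
Qed.

Lemma enorm_eq0 u : (enorm u == 0) = (u == 0).
Proof. by rewrite sqrtr_eq0 -dot_eq0 eq_le dot_ge0 andbT. Qed.

Lemma enorm_sqr u : enorm u ^+ 2 = dot u u.
Proof. by rewrite sqr_sqrtr// dot_ge0. Qed.

Lemma enormZ a u : enorm (a *: u) = `|a| * enorm u.
Proof.
by rewrite /enorm dotZl dotZr mulrA -expr2 sqrtrM ?sqr_ge0// sqrtr_sqr.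
Qed.

Lemma crossC u v : cross u v = - cross v u.
Proof.
have [c0 c1 c2] := crossE u v; have [d0 d1 d2] := crossE v u.
by apply: row3P; rewrite ?[RHS]mxE ?c0 ?c1 ?c2 ?d0 ?d1 ?d2; ring.
Qed.

Lemma crossuu u : cross u u = 0.
Proof.
have [c0 c1 c2] := crossE u u.
by apply: row3P; rewrite ?[RHS]mxE ?c0 ?c1 ?c2; ring.
Qed.

Lemma crossZl a u v : cross (a *: u) v = a *: cross u v.
Proof. by apply/rowP => k; rewrite !mxE; ring. Qed.

Lemma crossZr a u v : cross u (a *: v) = a *: cross u v.
Proof. by apply/rowP => k; rewrite !mxE; ring. Qed.

Lemma cross0l u : cross 0 u = 0.
Proof. by rewrite -(scale0r u) crossZl !scale0r. Qed.

Lemma cross0r u : cross u 0 = 0.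
Proof. by rewrite -(scale0r u) crossZr !scale0r. Qed.

Lemma crossDl u v w : cross (u + v) w = cross u w + cross v w.
Proof. by apply/rowP => k; rewrite !mxE; ring. Qed.

Lemma crossDr u v w : cross u (v + w) = cross u v + cross u w.
Proof. by apply/rowP => k; rewrite !mxE; ring. Qed.

Lemma dot_cross_rot u v w : dot (cross u v) w = dot (cross v w) u.
Proof.
have [c0 c1 c2] := crossE u v; have [d0 d1 d2] := crossE v w.
by rewrite !dotE c0 c1 c2 d0 d1 d2; ring.
Qed.

Lemma dot_crossl u v : dot (cross u v) u = 0.
Proof. by rewrite 2!dot_cross_rot crossuu dot0l. Qed.

Lemma dot_crossr u v : dot (cross u v) v = 0.
Proof. by rewrite dot_cross_rot crossuu dot0l. Qed.

Lemma cross_cross u v w : cross u (cross v w) = dot u w *: v - dot u v *: w.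
Proof.
have [c0 c1 c2] := crossE v w; have [d0 d1 d2] := crossE u (cross v w).
by apply: row3P; rewrite ?d0 ?d1 ?d2 ?c0 ?c1 ?c2 !mxE !dotE; ring.
Qed.

Lemma dot_cross_cross u v :
  dot (cross u v) (cross u v) = dot u u * dot v v - dot u v ^+ 2.
Proof.
by have [c0 c1 c2] := crossE u v; rewrite !dotE c0 c1 c2; ring.
Qed.

Lemma dot_comb (a b : R) u v w :
  dot (a *: u + b *: v) w = a * dot u w + b * dot v w.
Proof. by rewrite dotDl !dotZl. Qed.

(** The [v] component drops out because [cross u v] is orthogonal to [v]; exchanging [v] and [w] in
    the remaining triple product absorbs the sign. With [u], [v], [w] the first three derivatives of
    the curve and [b] = 1 / kappa, this is the determinant formula for the torsion. *)
Lemma dot_cross_comb (a b : R) u v w :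
  - dot (cross u (a *: v + b *: w)) (b *: v) = b ^+ 2 * dot (cross u v) w.
Proof.
rewrite crossDr !crossZr dotDl !dotZl !dotZr dot_crossr.
rewrite (dot_cross_rot u w v) (crossC w v) -(scaleN1r (cross v w)) dotZl.
by rewrite -dot_cross_rot; ring.
Qed.

Lemma not_free_scale a w : ~~ free [:: a *: w; w].
Proof. by rewrite free_cons span_seq1 memvZ// memv_line. Qed.

(** Crossing a relation a u + b v = 0 with [u] isolates b, and crossing it with [v] isolates a. Thus
    the Jacobian has full row rank at regular points. *)
Lemma row_free_col_mx u v : cross u v != 0 -> row_free (col_mx u v).
Proof.
move=> uv0; apply: inj_row_free => w; rewrite -[w]hsubmxK mul_row_col.
rewrite [lsubmx w]mx11_scalar [rsubmx w]mx11_scalar !mul_scalar_mx.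
move: (lsubmx w 0 0) (rsubmx w 0 0) => a b ab0.
have := congr1 (fun x => cross x v) ab0.
have := congr1 (fun x => cross u x) ab0.
rewrite crossDl crossDr !crossZl !crossZr !crossuu cross0l cross0r.
rewrite !scaler0 add0r addr0.
move=> /eqP; rewrite scaler_eq0 (negPf uv0) orbF => /eqP ->.
move=> /eqP; rewrite scaler_eq0 (negPf uv0) orbF => /eqP ->.
by rewrite !raddf0 row_mx0.
Qed.

End VectorAlgebra.

(** * Product rules for vector-valued functions *)

Section Derivatives.
Context {R : realType}.

(** Reduces the vector product rules below to scalar ones, entry by entry. *)
Lemma is_derive_mxP m n (M : R -> 'M[R]_(m, n)) (t : R) (M' : 'M[R]_(m, n)) :
  is_derive t 1 M M' <->
  forall i j, is_derive t 1 (fun x => M x i j) (M' i j).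
Proof.
split=> [[dM <-] i j|dM].
  by apply: DeriveDef; [exact: ((derivable_mxP _ _ _).1 dM)|rewrite derive_mx// mxE].
have dM1 : derivable M t 1 by apply/derivable_mxP => i j; have [] := dM i j.
apply: DeriveDef => //; apply/matrixP => i j; rewrite derive_mx// mxE.
by have [] := dM i j.
Qed.

Lemma is_derive_scale n (a : R -> R) (u : R -> 'rV[R]_n) (t a' : R) u' :
  is_derive t 1 a a' -> is_derive t 1 u u' ->
  is_derive t 1 (fun x => a x *: u x) (a' *: u t + a t *: u').
Proof.
move=> da /is_derive_mxP du; apply/is_derive_mxP => i j.
under eq_fun do rewrite mxE.
have dij := du i j.
apply: is_derive_eq.
by rewrite !mxE /GRing.scale/=; ring.
Qed.

Lemma is_derive_dot (u v : R -> 'rV[R]_3) (t : R) u' v' :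
  is_derive t 1 u u' -> is_derive t 1 v v' ->
  is_derive t 1 (fun x => dot (u x) (v x)) (dot u' (v t) + dot (u t) v').
Proof.
move=> /is_derive_mxP du /is_derive_mxP dv.
under eq_fun do rewrite dotE.
have du0 := du 0 0; have du1 := du 0 1; have du2 := du 0 2.
have dv0 := dv 0 0; have dv1 := dv 0 1; have dv2 := dv 0 2.
apply: is_derive_eq.
by rewrite !dotE /GRing.scale/=; ring.
Qed.

Lemma is_derive_cross (u v : R -> 'rV[R]_3) (t : R) u' v' :
  is_derive t 1 u u' -> is_derive t 1 v v' ->
  is_derive t 1 (fun x => cross (u x) (v x)) (cross u' (v t) + cross (u t) v').
Proof.
move=> /is_derive_mxP du /is_derive_mxP dv; apply/is_derive_mxP => i k.
under eq_fun do rewrite mxE.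
have du1 := du 0 (k + 1); have du2 := du 0 (k + 2).
have dv1 := dv 0 (k + 1); have dv2 := dv 0 (k + 2).
apply: is_derive_eq.
by rewrite !mxE /GRing.scale/=; ring.
Qed.

Lemma is_derive_enorm (u : R -> 'rV[R]_3) (t : R) u' :
  is_derive t 1 u u' -> u t != 0 ->
  is_derive t 1 (fun x => enorm (u x)) (dot (u t) u' / enorm (u t)).
Proof.
move=> du ut0.
have pos : 0 < dot (u t) (u t) by rewrite lt_def dot_eq0 ut0 dot_ge0.
have ddot := is_derive_dot du du.
have dsqrt := is_derive1_sqrt pos.
apply: (is_derive_eq (is_derive1_comp (f := Num.sqrt) _ _)).
rewrite [dot u' _]dotC -/(enorm (u t)).
by field; rewrite enorm_eq0.
Qed.

Lemma derive1_is_derive (V : normedModType R) (f : R -> V) (s : R) (f' : V) :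
  is_derive s 1 f f' -> derive1 f s = f'.
Proof. by move=> df; rewrite derive1E derive_val. Qed.

Lemma is_derive_continuous (f : R -> R) (s f' : R) :
  is_derive s 1 f f' -> {for s, continuous f}.
Proof.
by move=> [df _]; exact/differentiable_continuous/derivable1_diffP.
Qed.

End Derivatives.

(** * Local constancy of signs and continuous two-valued functions *)

Section RealFunctions.
Context {R : realType}.

Lemma sgr_near (g : R -> R) (t : R) :
  {for t, continuous g} -> g t != 0 ->
  \forall x \near t, Num.sg (g x) = Num.sg (g t).
Proof.
move=> gt; rewrite neq_lt => /orP[g0|g0].
  near=> x; rewrite !ltr0_sg//; near: x; exact: cvgr_lt gt _ g0.
near=> x; rewrite !gtr0_sg//; near: x; exact: cvgr_gt gt _ g0.
Unshelve. all: by end_near. Qed.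

(** Turns a pointwise alternative into a global one; it is applied to tau / kappa with the values 0
    and v. *)
Lemma two_valued_constant (I : set R) (g : R -> R) (x y : R) :
  is_interval I -> (forall s, I s -> {for s, continuous g}) ->
  (forall s, I s -> g s = x \/ g s = y) ->
  (forall s, I s -> g s = x) \/ (forall s, I s -> g s = y).
Proof.
move=> itvI cg gxy.
have const_le a b : I a -> I b -> a <= b -> g a = g b.
  move=> Ia Ib ab; apply/eqP/negPn/negP => gab.
  have abI c : c \in `[a, b] -> I c.
    by rewrite in_itv /= => acb; exact: itvI Ia Ib _ acb.
  have cont : {within `[a, b], continuous g}.
    by apply: continuous_in_subspaceT => z; rewrite inE /= => /abI/cg.
  (* If g a and g b differ, they are x and y in some order, so their midpoint is a value of g equal
     to neither. *)
  have [|c /abI/gxy gc gcE] := @IVT _ g a b ((g a + g b) / 2) ab cont.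
  - have /orP[] := le_total (g a) (g b) => ?;
    rewrite /Num.min /Num.max; case: ltP; lra.
  - move/eqP: gab; apply; move: (gxy a Ia) (gxy b Ib) gc; rewrite gcE.
    by move=> [->|->] [->|->] [] ?; lra.
apply: contrapT => /not_orP[/existsNP[a /not_implyP[Ia ga]]].
move=> /existsNP[b /not_implyP[Ib gb]].
have gab : g a = g b.
  by have /orP[] := le_total a b => ?; [|symmetry]; exact: const_le.
by case: (gxy a Ia) => // /[!gab].
Qed.

End RealFunctions.

(** * The shape operator on coordinate tangent vectors *)

Section RegularPoints.
Context {R : realType}.
Variables K U : R * R -> 'rV[R]_3.

(** Full row rank makes [pinvmx] a right inverse of the Jacobian, so it recovers the coordinates (1,
    0) of K_s. *)
Lemma shape_operator_partial1 p : regular_point K p ->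
  shape_operator K U p (partial1 K p) = - partial1 U p.
Proof.
move=> /row_free_col_mx/mulmxVp JV; rewrite /shape_operator.
have -> : partial1 K p = row_mx 1%:M 0 *m Defs.jacobian K p.
  by rewrite mul_row_col mul1mx mul0mx addr0.
by rewrite -(mulmxA _ (Defs.jacobian K p)) JV mulmx1 mul_row_col mul1mx mul0mx addr0.
Qed.

Lemma shape_operator_partial2 p : regular_point K p ->
  shape_operator K U p (partial2 K p) = - partial2 U p.
Proof.
move=> /row_free_col_mx/mulmxVp JV; rewrite /shape_operator.
have -> : partial2 K p = row_mx 0 1%:M *m Defs.jacobian K p.
  by rewrite mul_row_col mul1mx mul0mx add0r.
by rewrite -(mulmxA _ (Defs.jacobian K p)) JV mulmx1 mul_row_col mul1mx mul0mx add0r.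
Qed.

End RegularPoints.

(** * The Frenet frame and its derivatives *)

Section Frenet.
Context {R : realType}.
Variables (I : set R) (alpha : R -> 'rV[R]_3).
Hypotheses (I_open : open I) (alpha_smooth : smooth_on I alpha)
  (alpha_unit : unit_speed I alpha)
  (kappa_neq0 : forall s, I s -> curvature alpha s != 0).

Local Notation T := (frenetT alpha).
Local Notation N := (frenetN alpha).
Local Notation B := (frenetB alpha).
Local Notation k := (curvature alpha).
Local Notation tau := (torsion alpha).

(** Since [I] is open, equality on [I] is equality near each of its points, which is all that a
    derivative sees. *)
Lemma eq_on_is_derive (V : normedModType R) (f g : R -> V) (s : R) (f' : V) :
  I s -> (forall t, I t -> f t = g t) ->
  is_derive s 1 g f' -> is_derive s 1 f f'.
Proof.
move=> Is fg; apply: near_eq_is_derive.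
near=> t; apply/esym/fg; near: t; exact: open_nbhs_nbhs.
Unshelve. all: by end_near. Qed.

Lemma is_derive_derive1n n (s : R) : I s ->
  is_derive s 1 (derive1n n alpha) (derive1n n.+1 alpha s).
Proof.
by move=> Is; rewrite derive1nS derive1E; apply: derivableP; exact: alpha_smooth.
Qed.

Lemma alpha2_neq0 (s : R) : I s -> derive1n 2 alpha s != 0.
Proof. by move=> /kappa_neq0; rewrite enorm_eq0. Qed.

Lemma dotTT (s : R) : I s -> dot (T s) (T s) = 1.
Proof. by move=> /alpha_unit e; rewrite -enorm_sqr e expr1n. Qed.

Lemma dotNN (s : R) : I s -> dot (N s) (N s) = 1.
Proof.
move=> Is; rewrite /frenetN /normalize dotZl dotZr -enorm_sqr -/(k s).
by field; exact: kappa_neq0.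
Qed.

Lemma alpha2E (s : R) : I s -> derive1n 2 alpha s = k s *: N s.
Proof. by move=> Is; rewrite scalerA divff ?scale1r//; exact: kappa_neq0. Qed.

Lemma is_derive_T (s : R) : I s -> is_derive s 1 T (k s *: N s).
Proof. by move=> Is; rewrite -(alpha2E Is); exact: (is_derive_derive1n 1 Is). Qed.

(** Source of the component identities below: each comes from differentiating a constant inner
    product of two frame vectors. *)
Lemma dot_derive_const (u w : R -> 'rV[R]_3) (c : R) (s : R) u' w' :
  I s -> (forall t, I t -> dot (u t) (w t) = c) ->
  is_derive s 1 u u' -> is_derive s 1 w w' ->
  dot u' (w s) + dot (u s) w' = 0.
Proof.
move=> Is uwc du dw.
have := derive1_is_derive (is_derive_dot du dw).
have -> // : derive1 (fun t => dot (u t) (w t)) s = 0.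
apply: derive1_is_derive.
exact: (@eq_on_is_derive _ _ (cst c) _ _ Is uwc (is_derive_cst _ _ _)).
Qed.

(** Differentiating <T, T> = 1 gives 2 kappa <T, N> = 0. *)
Lemma dotTN (s : R) : I s -> dot (T s) (N s) = 0.
Proof.
move=> Is; have dT := is_derive_T Is.
have := dot_derive_const Is dotTT dT dT.
rewrite dotC dotZr => kTN.
have : k s * dot (T s) (N s) = 0 by lra.
by move=> /eqP; rewrite mulf_eq0 (negPf (kappa_neq0 Is)) => /eqP.
Qed.

Lemma dotNT (s : R) : I s -> dot (N s) (T s) = 0.
Proof. by move=> Is; rewrite dotC dotTN. Qed.

Lemma dotBB (s : R) : I s -> dot (B s) (B s) = 1.
Proof.
move=> Is; rewrite dot_cross_cross.
by rewrite dotTT// dotNN// dotTN// expr0n/= mul1r subr0.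
Qed.

Lemma dotBN (s : R) : dot (B s) (N s) = 0.
Proof. exact: dot_crossr. Qed.

Lemma crossNT (s : R) : cross (N s) (T s) = - B s.
Proof. exact: crossC. Qed.

Lemma crossNB (s : R) : I s -> cross (N s) (B s) = T s.
Proof.
move=> Is; rewrite /frenetB cross_cross dotNN// dotNT//.
by rewrite scale1r scale0r subr0.
Qed.

(** Orthogonality to T and N gives u x (T x N) = 0 by the double cross product formula; Lagrange's
    identity then reads |u|^2 |B|^2 - <u, B>^2 = 0, where |B| = 1 and <u, B> = 0. *)
Lemma frenet_ext (s : R) u : I s ->
  dot u (T s) = 0 -> dot u (N s) = 0 -> dot u (B s) = 0 -> u = 0.
Proof.
move=> Is uT uN uB; apply/eqP; rewrite -dot_eq0.
have : cross u (B s) = 0 by rewrite cross_cross uT uN !scale0r subr0.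
move=> /(congr1 (fun x => dot x x)); rewrite dot_cross_cross dot0l dotBB// uB.
by rewrite mulr1 expr0n subr0 => ->.
Qed.

(** This and [frenetN'] are what the chain and quotient rules give for |alpha''| and alpha'' /
    kappa. Keeping N' in terms of alpha'' and alpha''' leads to [torsionE]; its components along T
    and B are computed in [dotN'T] and [dotN'B]. *)
Definition curvature' s :=
  dot (derive1n 2 alpha s) (derive1n 3 alpha s) / k s.
Definition frenetN' s : 'rV[R]_3 :=
  (- (k s) ^- 2 * curvature' s) *: derive1n 2 alpha s
  + (k s)^-1 *: derive1n 3 alpha s.

Lemma is_derive_kappa (s : R) : I s -> is_derive s 1 k (curvature' s).
Proof.
move=> Is; exact: is_derive_enorm (is_derive_derive1n 2 Is) (alpha2_neq0 Is).
Qed.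

Lemma is_derive_N (s : R) : I s -> is_derive s 1 N (frenetN' s).
Proof.
move=> Is; apply: is_derive_scale (is_derive_derive1n 2 Is).
exact: is_deriveV (kappa_neq0 Is) (is_derive_kappa Is).
Qed.

Lemma is_derive_B_cross (s : R) : I s -> is_derive s 1 B (cross (T s) (frenetN' s)).
Proof.
move=> Is.
apply: is_derive_eq (is_derive_cross (is_derive_T Is) (is_derive_N Is)) _.
by rewrite crossZl crossuu scaler0 add0r.
Qed.

(* The definition of tau involves B', whose differentiability is not yet known;
   this formula expresses tau through derivatives of alpha only. *)
Lemma torsionE (s : R) : I s ->
  tau s = (k s) ^- 2 *
    dot (cross (derive1 alpha s) (derive1n 2 alpha s)) (derive1n 3 alpha s).
Proof.
move=> Is; rewrite /torsion (derive1_is_derive (is_derive_B_cross Is)).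
have -> : N s = (k s)^-1 *: derive1n 2 alpha s by [].
rewrite /frenetN' -exprVn -[T s]/(derive1 alpha s).
exact: dot_cross_comb.
Qed.

Lemma dotN'T (s : R) : I s -> dot (frenetN' s) (T s) = - k s.
Proof.
move=> Is.
have := dot_derive_const Is dotNT (is_derive_N Is) (is_derive_T Is).
by rewrite dotZr dotNN// => ?; lra.
Qed.

(** B' + tau N has no component in the frame: B' = T x N' is orthogonal to T, its N-component is -
    tau by definition of the torsion, and <B, B> = 1 kills its B-component. *)
Lemma is_derive_B (s : R) : I s -> is_derive s 1 B (- tau s *: N s).
Proof.
move=> Is; have dB := is_derive_B_cross Is.
apply: (is_derive_eq dB); apply/eqP; rewrite -subr_eq0 scaleNr opprK; apply/eqP.
apply: (frenet_ext Is); rewrite dotDl dotZl.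
- by rewrite dot_crossl dotNT// mulr0 addr0.
- by rewrite dotNN// mulr1 /torsion (derive1_is_derive dB) subrr.
- have := dot_derive_const Is dotBB dB dB.
  rewrite [dot (N s) _]dotC dotBN mulr0 addr0 [dot (B s) (cross _ _)]dotC => ?.
  by lra.
Qed.

Lemma dotN'B (s : R) : I s -> dot (frenetN' s) (B s) = tau s.
Proof.
move=> Is.
have dotNB t : I t -> dot (N t) (B t) = 0 by move=> _; rewrite dotC dotBN.
have := dot_derive_const Is dotNB (is_derive_N Is) (is_derive_B Is).
by rewrite dotZr dotNN// => ?; lra.
Qed.

(** By [torsionE], tau agrees on [I] with an expression in kappa and the first three derivatives of
    alpha, all of which are derivable. *)
Lemma derivable_torsion (s : R) : I s -> derivable tau s 1.
Proof.
move=> Is.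
have d1 := is_derive_derive1n 1 Is; have d2 := is_derive_derive1n 2 Is.
have d3 := is_derive_derive1n 3 Is; have dk := is_derive_kappa Is.
have dV : is_derive s 1 (fun t => (k t)^-1) _ := is_deriveV (kappa_neq0 Is) dk.
have ddet := is_derive_dot (is_derive_cross d1 d2) d3.
have := is_deriveM (is_deriveX 2 dV) ddet.
move=> /(eq_on_is_derive Is) H; apply: ex_derive; apply: H => t It.
by rewrite torsionE// -exprVn.
Qed.

(** * Partial derivatives and unit normal of the Darboux developable *)

Local Notation K := (darboux alpha).
Local Notation U := (darboux_normal alpha).

(* The factor of N in K_s. *)
Definition s_coeff v s := v * k s - tau s.

Lemma is_derive_s_coeff v (s : R) : I s ->
  is_derive s 1 (s_coeff v) (derive1 (s_coeff v) s).
Proof.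
move=> Is; rewrite derive1E; apply: derivableP.
apply: (derivableB _ (derivable_torsion Is)).
apply: (derivableM (derivable_cst _ _ _)).
exact: (@ex_derive _ _ _ _ _ _ _ (is_derive_kappa Is)).
Qed.

Lemma s_coeff_eq0 v (s : R) : I s -> (s_coeff v s == 0) = (tau s / k s == v).
Proof.
by move=> Is; rewrite subr_eq0 eq_sym -(divfK (kappa_neq0 Is) (tau s))
  (inj_eq (mulIf (kappa_neq0 Is))) mulfK// kappa_neq0.
Qed.

Lemma ratio_eq0 (s : R) : I s -> (tau s / k s == 0) = (tau s == 0).
Proof. by move=> Is; rewrite mulf_eq0 invr_eq0 (negPf (kappa_neq0 Is)) orbF. Qed.

Lemma is_derive_darboux1 v (s : R) : I s ->
  is_derive s 1 (fun t => K (t, v)) (s_coeff v s *: N s).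
Proof.
move=> Is.
have dvT := is_derive_scale (is_derive_cst v s 1) (is_derive_T Is).
apply: (is_derive_eq (is_deriveD (is_derive_B Is) dvT)).
by rewrite scale0r add0r (scalerA (cst v s)) -scalerDl addrC.
Qed.

Lemma partial1_darboux v (s : R) : I s -> partial1 K (s, v) = s_coeff v s *: N s.
Proof. by move=> Is; exact: derive1_is_derive (is_derive_darboux1 v Is). Qed.

Lemma partial2_darboux v (s : R) : partial2 K (s, v) = T s.
Proof.
apply: derive1_is_derive.
have dvT := is_derive_scale (is_derive_id v 1) (is_derive_cst (T s) v 1).
apply: (is_derive_eq (is_deriveD (is_derive_cst (B s) v 1) dvT)).
by rewrite add0r scaler0 addr0 scale1r.
Qed.

Lemma normal_vector_darboux v (s : R) : I s ->
  normal_vector K (s, v) = - s_coeff v s *: B s.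
Proof.
move=> Is; rewrite /normal_vector partial1_darboux// partial2_darboux.
by rewrite crossZl crossNT scalerN scaleNr.
Qed.

Lemma normal_vector_eq0 v (s : R) : I s ->
  (normal_vector K (s, v) == 0) = (s_coeff v s == 0).
Proof.
move=> Is; rewrite normal_vector_darboux// scaler_eq0 oppr_eq0.
by rewrite -[B s == 0]dot_eq0 dotBB// oner_eq0 orbF.
Qed.

Lemma darboux_normal_regular v (s : R) : I s -> s_coeff v s != 0 ->
  U (s, v) = - Num.sg (s_coeff v s) *: B s.
Proof.
move=> Is f0; rewrite /darboux_normal normal_vector_eq0// (negPf f0).
rewrite normal_vector_darboux// /normalize scalerA enormZ.
rewrite /(enorm (B s)) dotBB// sqrtr1 mulr1 normrN mulrN.
congr (- _ *: _).
(* Writing f = sg(f) |f| lets the norm |f| cancel. *)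
by rewrite [X in _ * X]numEsg mulrCA mulVf ?normr_eq0// mulr1.
Qed.

(** Treats regular and singular points together: the asymptotic and geodesic conditions are
    unaffected by a nonzero factor on the normal. *)
Lemma darboux_normalE v (s : R) : I s ->
  exists2 e, e != 0 & U (s, v) = e *: B s.
Proof.
move=> Is; have [f0|f0] := eqVneq (s_coeff v s) 0.
  exists 1; first exact: oner_neq0.
  by rewrite /darboux_normal normal_vector_eq0// f0 eqxx scale1r.
exists (- Num.sg (s_coeff v s)); first by rewrite oppr_eq0 sgr_eq0.
exact: darboux_normal_regular.
Qed.

(** * Asymptotic and geodesic s-parameter curves *)

Lemma darboux_s_curve_acceleration v (s : R) : I s ->
  derive1n 2 (K \o s_curve v) s =
  derive1 (s_coeff v) s *: N s + s_coeff v s *: frenetN' s.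
Proof.
move=> Is; apply: derive1_is_derive.
apply: (eq_on_is_derive Is) (is_derive_scale (is_derive_s_coeff v Is) (is_derive_N Is)).
by move=> t It; exact: partial1_darboux.
Qed.

(** The acceleration f' N + f N' has B-component f tau. Both factors are tested on the ratio tau /
    kappa, the form that [two_valued_constant] takes. *)
Lemma asymptotic_s_curveP v :
  asymptotic_curve K U I (s_curve v) <->
  forall s, I s -> tau s / k s = 0 \/ tau s / k s = v.
Proof.
have pt s : I s -> dot (U (s, v)) (derive1n 2 (K \o s_curve v) s) = 0 <->
    tau s / k s = 0 \/ tau s / k s = v.
  move=> Is; have [e e0 ->] := darboux_normalE v Is.
  rewrite darboux_s_curve_acceleration// dotZl dotC dot_comb.
  rewrite (dotC (N s)) dotBN dotN'B// mulr0 add0r.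
  split=> [/eqP|H]; last first.
    apply/eqP; rewrite !mulf_eq0 s_coeff_eq0// -ratio_eq0//.
    by case: H => /eqP ->; rewrite !orbT.
  rewrite !mulf_eq0 (negPf e0)/= s_coeff_eq0// -ratio_eq0//.
  by move=> /orP[] /eqP; [right|left].
by split=> H s Is; apply/(pt s Is); exact: H.
Qed.

Lemma geodesic_s_curveP v :
  geodesic_curve K U I (s_curve v) <-> helix_of_ratio I alpha v.
Proof.
split=> H s Is.
  apply/eqP; rewrite -s_coeff_eq0//; apply/eqP.
  (* Rotating the triple product, <B x K_ss, N> = <N x B, K_ss> = <T, K_ss> = - f kappa. *)
  have := congr1 (fun x => dot x (N s)) (H s Is); rewrite dot0l.
  rewrite /s_curve; have [e e0 ->] := darboux_normalE v Is.
  rewrite -/(s_curve v) crossZl dotZl dot_cross_rot dot_cross_rot crossNB//.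
  rewrite darboux_s_curve_acceleration// dotC dot_comb dotNT// dotN'T//.
  move/eqP; rewrite mulr0 add0r !mulf_eq0 oppr_eq0 (negPf e0).
  by rewrite (negPf (kappa_neq0 Is)) orbF => /eqP.
rewrite darboux_s_curve_acceleration//.
(* As f vanishes on all of [I], so does f', and the acceleration itself is zero. *)
have f0 t : I t -> s_coeff v t = 0.
  by move=> It; apply/eqP; rewrite s_coeff_eq0// H.
rewrite (derive1_is_derive (eq_on_is_derive Is f0 (is_derive_cst 0 s 1))).
by rewrite f0// !scale0r addr0 cross0r.
Qed.

(** * Partial derivatives of the unit normal *)

Lemma partial1_darboux_normal v (s : R) : I s -> s_coeff v s != 0 ->
  partial1 U (s, v) = (Num.sg (s_coeff v s) * tau s) *: N s.
Proof.
move=> Is f0; apply: derive1_is_derive.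
have dcst := is_derive_cst (- Num.sg (s_coeff v s)) s 1.
have cf : {for s, continuous (s_coeff v)}.
  exact: is_derive_continuous (is_derive_s_coeff v Is).
have := is_derive_scale dcst (is_derive_B Is).
rewrite scale0r add0r scalerA mulrNN; apply: near_eq_is_derive.
(* The sign of f is constant near s, so U is there a fixed multiple of B. *)
near=> t; have It : I t by near: t; exact: open_nbhs_nbhs.
have sgt : Num.sg (s_coeff v t) = Num.sg (s_coeff v s).
  by near: t; exact: sgr_near.
have ft : s_coeff v t != 0 by rewrite -sgr_eq0 sgt sgr_eq0.
have Ut := darboux_normal_regular It ft.
by rewrite sgt in Ut; rewrite Ut.
Unshelve. all: by end_near. Qed.

Lemma partial2_darboux_normal v (s : R) : I s -> s_coeff v s != 0 ->
  partial2 U (s, v) = 0.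
Proof.
move=> Is f0; apply: derive1_is_derive.
have cf : {for v, continuous (s_coeff^~ s)}.
  exact: (cvgB (cvgM cvg_id (cvg_cst _)) (cvg_cst _)).
apply: near_eq_is_derive (is_derive_cst (U (s, v)) v 1).
(* B does not depend on v, and f keeps its sign near v, so U is locally constant along the
   ruling. *)
near=> w.
have sgw : Num.sg (s_coeff w s) = Num.sg (s_coeff v s).
  by near: w; exact: (@sgr_near _ (s_coeff^~ s)).
have fw : s_coeff w s != 0 by rewrite -sgr_eq0 sgw sgr_eq0.
have Uw := darboux_normal_regular Is fw; rewrite sgw in Uw.
by rewrite Uw -(darboux_normal_regular Is f0).
Unshelve. all: by end_near. Qed.

(** * The ratio tau / kappa *)

Lemma torsion_curvature_continuous (s : R) : I s ->
  {for s, continuous (fun t => tau t / k t)}.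
Proof.
move=> Is; have ck := is_derive_continuous (is_derive_kappa Is).
have ct := is_derive_continuous (derivableP (derivable_torsion Is)).
exact: (cvgM ct (cvgV (kappa_neq0 Is) ck)).
Qed.

Lemma plane_curveP :
  plane_curve I alpha <-> forall s, I s -> tau s / k s = 0.
Proof.
split=> H s Is; first by rewrite H// mul0r.
by apply/eqP; rewrite -ratio_eq0//; apply/eqP/H.
Qed.

(** * Lines of curvature and rulings *)

Lemma darboux_s_curve_line_of_curvature v :
  line_of_curvature K U I (s_curve v).
Proof.
move=> s Is reg; rewrite -[derive1 _ s]/(partial1 K (s_curve v s)).
rewrite shape_operator_partial1//.
have f0 : s_coeff v s != 0 by rewrite -normal_vector_eq0.
rewrite partial1_darboux// partial1_darboux_normal//.
set c := _ * tau s.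
(* U_s and K_s are both multiples of N; regularity allows the division by f. *)
have -> : - (c *: N s) = (- c / s_coeff v s) *: (s_coeff v s *: N s).
  by rewrite [RHS]scalerA divfK// scaleNr.
exact: not_free_scale.
Qed.

Lemma darboux_v_curve_line_of_curvature (s : R) : I s ->
  line_of_curvature K U [set: R] (v_curve s).
Proof.
move=> Is v _ reg; rewrite -[derive1 _ v]/(partial2 K (v_curve s v)).
rewrite shape_operator_partial2//.
have f0 : s_coeff v s != 0 by rewrite -normal_vector_eq0.
rewrite partial2_darboux_normal// oppr0.
(* The ruling is a principal direction with principal curvature 0. *)
rewrite -(scale0r (partial2 K (v_curve s v))); exact: not_free_scale.
Qed.

Lemma darboux_v_curve_straight (s : R) : I s ->
  is_straight_line (range (K \o v_curve s)).
Proof.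
(* The parametrization v |-> B(s) + v T(s) is already that of a line; its direction is nonzero
   because T is a unit vector. *)
move=> Is; exists (B s), (T s); split=> //.
by rewrite -dot_eq0 dotTT// oner_eq0.
Qed.

End Frenet.

Unset Implicit Arguments.

(** For one given v the helix ratio is forced to equal v, so a helix of arbitrary ratio is matched
    only by letting v vary. Hence (i) and (ii) each come in an existential form and in a sharper
    form for each v. *)
Theorem theorem8 (R : realType) (I : set R) (alpha : R -> 'rV[R]_3)
    (I_open : open I) (I_interval : is_interval I)
    (alpha_smooth : smooth_on I alpha)
    (alpha_unit : unit_speed I alpha)
    (kappa_neq0 : forall s, I s -> curvature alpha s != 0) :
  let K := darboux alpha in
  let U := darboux_normal alpha in
  (* (i) *)
  (((exists v, asymptotic_curve K U I (s_curve v)) <->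
      plane_curve I alpha \/ general_helix I alpha) /\
   (forall v, asymptotic_curve K U I (s_curve v) <->
      plane_curve I alpha \/ helix_of_ratio I alpha v)) /\
  (* (ii) *)
  (((exists v, geodesic_curve K U I (s_curve v)) <->
      general_helix I alpha) /\
   (forall v, geodesic_curve K U I (s_curve v) <->
      helix_of_ratio I alpha v)) /\
  (* (iii) *)
  (forall s, I s -> is_straight_line (range (K \o v_curve s))) /\
  (* (iv) *)
  ((forall v, line_of_curvature K U I (s_curve v)) /\
   (forall s, I s -> line_of_curvature K U [set: R] (v_curve s))).
Proof.
move=> K U.
have asym v : asymptotic_curve K U I (s_curve v) <->
    plane_curve I alpha \/ helix_of_ratio I alpha v.
  rewrite asymptotic_s_curveP// plane_curveP//.
  split=> [|[H|H] s Is]; [|by left; exact: H|by right; exact: H].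
  (* Connectedness of [I] enters here: tau / kappa cannot switch between 0 and v. *)
  apply: two_valued_constant => // s Is.
  exact: torsion_curvature_continuous alpha_smooth kappa_neq0 s Is.
have geod v : geodesic_curve K U I (s_curve v) <-> helix_of_ratio I alpha v.
  exact: geodesic_s_curveP.
split; first split=> //.
  split=> [[v /asym[plane|helix]]|[plane|[c helix]]].
  - by left.
  - by right; exists v.
  (* For a plane curve every v works; 0 is an arbitrary choice. *)
  - by exists 0; apply/asym; left.
  - by exists c; apply/asym; right.
split; first split=> //.
  by split=> [[v /geod helix]|[c helix]]; [exists v|exists c; apply/geod].
split; first by move=> s; exact: darboux_v_curve_straight.
split; first by move=> v; exact: darboux_s_curve_line_of_curvature.
by move=> s Is; exact: darboux_v_curve_line_of_curvature Is.
Qed.
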